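(* Let $X$ be symmetrically self-similar with respect to $F$ and $\phi=\psi^{-1}$. For $x\in VX\setminus F$ let $C(x)$ be the cell containing $x$. Let $x,y\in VX\setminus F$ and $v,w\in F$. Then, for $z$ in the open unit disc: (i) $G(v,w|z)=G(\phi v,\phi w|d(z))\cdot f(z)$; (ii) $G(x,w|z)=\sum_{v'\in\theta C(x)}h_{C(x)}(x,v'|z)\,G(\phi v',\phi w|d(z))\,f(z)$ and $G(v,y|z)=\sum_{w'\in\theta C(y)}G(\phi v,\phi w'|d(z))\,f(z)\,\tilde h_{C(y)}(w',y|z)$; (iii) $G(x,y|z)=\delta_{C(x),C(y)}\,h_{C(x)}(x,y|z)+\sum_{v'\in\theta C(x),\,w'\in\theta C(y)}h_{C(x)}(x,v'|z)\,G(\phi v',\phi w'|d(z))\,f(z)\,\tilde h_{C(y)}(w',y|z)$, where $\delta$ is the Kronecker symbol.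
   Context: Graphs are connected, locally finite, infinite, undirected, without loops or multiple edges. For $C\subseteq VX$, $\theta C$ is the set of vertices of $VX\setminus C$ adjacent to a vertex of $C$, $\overline C=C\cup\theta C$. For $F\subseteq VX$, $\mathcal{C}_X(F)$ is the set of connected components (as vertex sets) of the subgraph induced on $VX\setminus F$ (cells). The reduced graph $X_F$ has vertex set $F$, distinct $x,y$ adjacent iff $x,y\in\theta C$ for some cell $C$. $X$ is self-similar with respect to $F$ if (F1) no two vertices of $F$ are adjacent in $X$, (F2) distinct $C,D\in\mathcal{C}_X(F)$ satisfy $|\overline C\cap\overline D|\le1$, (F3) there is a graph isomorphism $\psi:X\to X_F$; $\phi=\psi^{-1}$. $\hat C$ is the subgraph induced on $\overline C$. Symmetrically self-similar: additionally (S1) all cells finite and any two $\hat C,\hat D$ isomorphic via a map sending $\theta C$ onto $\theta D$; (S3) automorphisms of $\hat C$ preserving $\theta C$ act doubly transitively on $\theta C$. $\theta_X=|\theta C|$. $G(x,y|z)=\sum_n p^{(n)}(x,y)z^n$ for the simple random walk on $X$. For $B\subseteq\theta C$, $Q_B$ on $V\hat C$ has entries $1/\deg_{\hat C}x$ if $x\sim y$, $x\notin B$, else 0; $Q^*_B(z)=(I-zQ_B)^{-1}$. For distinct $a,b\in\theta C$: $d(z)=(\theta_X-1)(Q^*_{\theta C\setminus\{a\}}(z))_{a,b}$, $f(z)=(Q^*_{\theta C\setminus\{a\}}(z))_{a,a}$. Inner transition functions: $h_C(x,y|z)=(Q^*_{\theta C}(z))_{x,y}$ for $x\in C$, $y\in\overline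 C$, and $\tilde h_C(x,y|z)=\frac{\deg_{\hat C}y}{\deg_{\hat C}x}h_C(y,x|z)$ for $x\in\theta C$, $y\in C$.
   Formalization: In the definition of h̃_C(x,y|z) the denominator deg_{Ĉ} x is replaced by deg_X x, the degree in the whole graph, since with deg_{Ĉ} x the second formula of (ii) and (iii) fail, e.g. for X=Z, F=2Z. *)

(* Defs.v *)
From mathcomp Require Import all_boot all_order all_algebra finmap.
From mathcomp Require Import all_classical all_reals all_analysis.
From mathcomp Require Import complex.

Set Implicit Arguments.
Unset Strict Implicit.
Unset Printing Implicit Defensive.

Import Order.TTheory GRing.Theory Num.Theory numFieldNormedType.Exports.

Local Open Scope classical_set_scope.
Local Open Scope ring_scope.

(* A graph is an adjacency relation e on a type V; the graph induced on a set
   A : set V is the pair (A, e). *)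

Definition nbr (V : choiceType) (e : rel V) (x : V) : set V := [set y | e x y].

Definition linked (V : choiceType) (e : rel V) (A : set V) (x y : V) : Prop :=
  exists p : seq V, [/\ path e x p, last x p = y & {subset x :: p <= A}].

Definition component (V : choiceType) (e : rel V) (A : set V) (x : V) : set V :=
  [set y | linked e A x y].

Record infinite_graph (V : choiceType) (e : rel V) : Prop := InfiniteGraph {
  graph_sym : symmetric e;
  graph_irr : irreflexive e;
  graph_connected : forall x y : V, linked e setT x y;
  graph_locally_finite : forall x : V, finite_set (nbr e x);
  graph_infinite : infinite_set [set: V] }.

(* f restricts to an isomorphism from the graph (A, e) to the graph (B, e'). *)
Definition graph_iso (V W : choiceType) (A : set V) (e : rel V)
    (B : set W) (e' : rel W) (f : V -> W) : Prop :=
  set_bij A B f /\ (forall x y, A x -> A y -> e x y = e' (f x) (f y)).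

Definition theta (V : choiceType) (e : rel V) (C : set V) : set V :=
  [set v | ~ C v /\ exists2 u, C u & e u v].

Definition bar (V : choiceType) (e : rel V) (C : set V) : set V :=
  C `|` theta e C.

Definition cell_of (V : choiceType) (e : rel V) (F : set V) (x : V) : set V :=
  component e (~` F) x.

Definition cells (V : choiceType) (e : rel V) (F : set V) : set (set V) :=
  cell_of e F @` (~` F).

(* Adjacency of the reduced graph, whose vertex set is F. *)
Definition reduced_adj (V : choiceType) (e : rel V) (F : set V) : rel V :=
  fun x y => (x != y) &&
    `[< exists C, [/\ cells e F C, theta e C x & theta e C y] >].

Record self_similar (V : choiceType) (e : rel V) (F : set V) (psi : V -> V) :
    Prop := SelfSimilar {
  axiomF1 : forall x y, F x -> F y -> ~~ e x y;
  axiomF2 : forall C D, cells e F C -> cells e F D -> C <> D ->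
    is_subset1 (bar e C `&` bar e D);
  axiomF3 : graph_iso [set: V] e F (reduced_adj e F) psi }.

Record symmetrically_self_similar (V : choiceType) (e : rel V) (F : set V)
    (psi : V -> V) : Prop := SymmetricallySelfSimilar {
  sss_self_similar : self_similar e F psi;
  axiomS1_finite : forall C, cells e F C -> finite_set C;
  axiomS1_iso : forall C D, cells e F C -> cells e F D ->
    exists2 g : V -> V, graph_iso (bar e C) e (bar e D) e g
                      & g @` theta e C = theta e D;
  axiomS3 : forall C, cells e F C -> forall x y x' y',
    theta e C x -> theta e C y -> x <> y ->
    theta e C x' -> theta e C y' -> x' <> y' ->
    exists g : V -> V, [/\ graph_iso (bar e C) e (bar e C) e g,
      g @` theta e C = theta e C, g x = x' & g y = y'] }.

(* The degree of x in the graph induced on A. *)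
Definition degree (V : choiceType) (e : rel V) (A : set V) (x : V) : nat :=
  #|` fset_set (A `&` nbr e x)|.

Fixpoint srw (K : numFieldType) (V : choiceType) (e : rel V) (n : nat)
    (x y : V) : K :=
  match n with
  | 0%N => (x == y)%:R
  | m.+1 => \sum_(u \in nbr e x) ((degree e setT x)%:R^-1 * srw K e m u y)
  end.

Definition green (K : numFieldType) (V : choiceType) (e : rel V) (x y : V)
    (z : K) : K :=
  limn (series (fun n => srw K e n x y * z ^+ n)).

Definition barT (V : choiceType) (e : rel V) (C : set V) : finType :=
  fset_set (bar e C).

Definition Qmx (K : numFieldType) (V : choiceType) (e : rel V) (C B : set V) :
    'M[K]_#|barT e C| :=
  \matrix_(i, j)
    let x := val (enum_val i : barT e C) in let y := val (enum_val j : barT e C) in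
    if e x y && (x \notin B) then (degree e (bar e C) x)%:R^-1 else 0.

(* The (x, y) entry of (I - z Q_B)^-1; 0 if x or y is not in bar e C. *)
Definition Qstar (K : numFieldType) (V : choiceType) (e : rel V) (C B : set V)
    (z : K) (x y : V) : K :=
  match (insub x : option (barT e C)),
        (insub y : option (barT e C)) with
  | Some i, Some j =>
      invmx (1%:M - z *: Qmx K e C B) (enum_rank i) (enum_rank j)
  | _, _ => 0
  end.

Definition d_fun (K : numFieldType) (V : choiceType) (e : rel V) (C : set V)
    (a b : V) (z : K) : K :=
  (#|` fset_set (theta e C)|%:R - 1) * Qstar e C (theta e C `\ a) z a b.

Definition f_fun (K : numFieldType) (V : choiceType) (e : rel V) (C : set V)
    (a : V) (z : K) : K :=
  Qstar e C (theta e C `\ a) z a a.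

Definition h_fun (K : numFieldType) (V : choiceType) (e : rel V) (C : set V)
    (x y : V) (z : K) : K :=
  Qstar e C (theta e C) z x y.

(* For x in theta C and y in C. The denominator is the degree of x in the whole
   graph X, not in the graph induced on bar C: reversibility of the walk on X
   gives m(x) L(x, y) = m(y) h_C(y, x) with m the degree in X, L(x, y) being the
   generating function of the walks from x to y that do not return to F. For y
   in C the two degrees agree; for x in theta C the degree in X is the degree in
   the graph induced on bar C times the number of cells with x in their
   boundary. With the latter degree in the denominator the identities for
   G(v, y | z) and G(x, y | z) fail: for X = Z and F = 2Z,
   G(0, 1 | z) = (z / 2) (G(0, 0 | z) + G(0, 2 | z)), but the last factor
   would be z in place of z / 2. *)
Definition htilde (K : numFieldType) (V : choiceType) (e : rel V) (C : set V)
    (x y : V) (z : K) : K :=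
  (degree e (bar e C) y)%:R / (degree e setT x)%:R * h_fun e C y x z.

(* Main.v *)
Require Import Defs.
From mathcomp Require Import all_boot all_order all_algebra finmap.
From mathcomp Require Import all_classical all_reals all_analysis.
From mathcomp Require Import complex ring.

(* For |z| < 1 the function G(., y | z) is the only bounded solution of
   g = delta_y + z P g, P being the averaging operator of the walk. On a cell C
   with v in its boundary, inverting I - z Q_B for B = theta C \ v expresses g v
   through g on B and through g v - z (average of g over the neighbours of v
   in C), with coefficients d / (theta_X - 1) and f which do not depend on C by
   symmetry. Averaging over the cells around v turns g = delta_w + z P g, w in
   F, into g = f delta_w + d P_F g for the walk P_F on the reduced graph, and
   uniqueness for the parameter d gives (i); that |d| < 1 is the maximum
   principle. Inverting I - z Q_B for B = theta C extends the formulas to the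
   starting points off F, and reversibility to the end points off F. *)

Set Implicit Arguments.
Unset Strict Implicit.
Unset Printing Implicit Defensive.

Import Order.TTheory GRing.Theory Num.Theory numFieldNormedType.Exports.

Local Open Scope classical_set_scope.
Local Open Scope ring_scope.

(** * Domination by geometric series *)

(** The one completeness property that the argument uses. With it as a hypothesis everything up to
    the final theorem runs over a general [numFieldType]; it is then checked for [R[i]]. *)
Definition geometrically_complete (K : numFieldType) : Prop :=
  forall (z : K) (u : nat -> K), `|z| < 1 ->
  (forall n, `|u n| <= `|z| ^+ n) -> cvgn (series u).

(** A [numFieldType] may be non-archimedean, so [|z| < 1] alone does not make the powers of [|z|]
    tend to 0; here they do, being the terms of a series that converges by
    [geometrically_complete]. *)
Lemma ler_geometric_lim (K : numFieldType) (z t c M : K) :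
  geometrically_complete K -> `|z| < 1 -> 0 <= c ->
  (forall n, `|t| <= c + `|z| ^+ n * M) -> `|t| <= c.
Proof.
move=> hK z1 c0 tcM.
have [//|] := real_leP (normr_real t) (ger0_real c0).
rewrite -subr_gt0 => tc.
have M1 : 0 < `|M| + 1 by rewrite ltr_wpDl.
have e0 : 0 < (`|t| - c) / (`|M| + 1) by rewrite divr_gt0.
have z0 : (fun n => `|z| ^+ n) @ \oo --> (0 : K).
  apply: cvg_series_cvg_0; apply: (hK z) => // n.
  by rewrite normrX normr_id.
have /cvgrPdist_lt/(_ _ e0)[N _ /(_ N (leqnn _))/=] := z0.
rewrite sub0r normrN normrX normr_id ltr_pdivlMr// => lt1.
have lt2 : `|z| ^+ N * M < `|t| - c.
  apply: le_lt_trans lt1.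
  (* [M] is not assumed real: the product is real because adding the real [c] makes it comparable
     with the real [|t|]. *)
  have tM : `|z| ^+ N * M \is Num.real.
    have := tcM N => /ler_real; rewrite normr_real => /esym.
    by move=> h; rewrite -(addKr c (_ * M)) rpredD ?rpredN// ger0_real.
  rewrite (le_trans (real_ler_norm tM))// normrM normrX normr_id.
  by rewrite ler_wpM2l ?exprn_ge0// lerDl.
by move: (tcM N); rewrite -lerBlDl => /le_lt_trans /(_ lt2); rewrite ltxx.
Qed.

(** * Convergence of complex series through real and imaginary parts *)

Section ComplexSeries.
Variable R : realType.
Implicit Types (z : R[i]) (s u : nat -> (R[i] : numFieldType)).

Lemma normc_le_ReIm z :
  `|z| <= (`|complex.Re z| + `|complex.Im z|)%:C%C.
Proof.
rewrite {1}[z]complexE (le_trans (ler_normD _ _))// normrM.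
have nR (r : R) : `|r%:C%C| = `|r|%:C%C :> R[i].
  by rewrite normc_def/= expr0n/= addr0 sqrtr_sqr.
rewrite !nR rmorphD/= lerD2l normc_def/= expr0n/= expr1n add0r sqrtr1.
by rewrite mul1r.
Qed.

Lemma normc_ge_ReIm z :
  `|complex.Re z|%:C%C <= `|z| /\ `|complex.Im z|%:C%C <= `|z|.
Proof.
split; first exact: normc_ge_Re.
(* Multiplication by [-i] keeps the modulus and turns the imaginary part into the real part. *)
have -> : `|z| = `| - 'i%C * z |.
  by rewrite normrM normrN (normc_def 'i%C)/= expr0n/= expr1n add0r sqrtr1 mul1r.
apply: le_trans (normc_ge_Re _).
by case: z => a b /=; rewrite lecR; simpc.
Qed.

Lemma cvgn_complex s :
  cvgn (fun n => complex.Re (s n)) -> cvgn (fun n => complex.Im (s n)) ->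
  cvgn s.
Proof.
set a := limn (fun n => complex.Re (s n)) => sa.
set b := limn (fun n => complex.Im (s n)) => sb.
apply: (@cvgP _ _ ((a +i* b)%C : (R[i] : numFieldType))).
apply/cvgrPdist_lt => e e0.
have eR : e = (complex.Re e)%:C%C by rewrite RRe_real// gtr0_real.
have e0' : 0 < complex.Re e / 2.
  by rewrite divr_gt0// -ltcR -eR.
move/cvgrPdist_lt/(_ _ e0'): sa => sa; move/cvgrPdist_lt/(_ _ e0'): sb => sb.
near=> n.
rewrite (le_lt_trans (normc_le_ReIm _))// eR ltcR [ltRHS]splitr.
have -> : complex.Re ((a +i* b)%C - s n) = a - complex.Re (s n).
  by rewrite raddfB.
have -> : complex.Im ((a +i* b)%C - s n) = b - complex.Im (s n).
  by rewrite raddfB.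
by apply: ltrD; near: n.
Unshelve. all: end_near. Qed.

(** Real and imaginary parts are each dominated by the real geometric series of ratio [|z|], so both
    converge absolutely. *)
Lemma complex_geometrically_complete :
  geometrically_complete (R[i] : numFieldType).
Proof.
move=> z u z1 uz.
have zR : `|z| = (complex.Re `|z|)%:C%C by rewrite RRe_real// normr_real.
set r := complex.Re `|z| in zR.
have r0 : 0 <= r by rewrite -ler0c -zR normr_ge0.
have r1 : `|r| < 1 by rewrite ger0_norm// -ltcR -zR.
have cvgr (v : nat -> R) : (forall n, `|v n| <= r ^+ n) -> cvgn (series v).
  move=> vr; apply: normed_cvg.
  apply: series_le_cvg (is_cvg_geometric_series (a := 1) r1) => n //=.
    by rewrite mul1r exprn_ge0.
  by rewrite mul1r.
have uRI n : `|complex.Re (u n)| <= r ^+ n /\ `|complex.Im (u n)| <= r ^+ n.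
  have [uR uI] := normc_ge_ReIm (u n).
  split; rewrite -lecR; apply: le_trans (_ : `|u n| <= _) => //;
    by rewrite rmorphXn/= -zR.
apply: cvgn_complex.
- have /cvgr : forall n, `|complex.Re (u n)| <= r ^+ n by move=> n; case: (uRI n).
  by congr (cvgn _); apply/funext => n; rewrite /series/= raddf_sum.
- have /cvgr : forall n, `|complex.Im (u n)| <= r ^+ n by move=> n; case: (uRI n).
  by congr (cvgn _); apply/funext => n; rewrite /series/= raddf_sum.
Qed.

End ComplexSeries.

(** * Sums over finite sets *)

(** For an infinite set [fset_set] is empty and the claim is vacuous. *)
Lemma fset_set_mem (T : choiceType) (A : set T) (x : T) :
  x \in fset_set A -> A x.
Proof.
have [fA|iA] := pselect (finite_set A); first by rewrite in_fset_set// inE.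
by rewrite /fset_set; case: pselect => // _; rewrite inE.
Qed.

Lemma mem_fset_set (T : choiceType) (A : set T) (x : T) :
  finite_set A -> A x -> x \in fset_set A.
Proof. by move=> fA Ax; rewrite in_fset_set// inE. Qed.

Lemma sumr_fset_const (K : pzRingType) (T : choiceType) (A : {fset T}) (c : K) :
  \sum_(u <- A) c = #|` A|%:R * c.
Proof. by rewrite big_const_seq count_predT iter_addr_0 mulr_natl. Qed.

Lemma sumr_fset_delta (K : pzRingType) (T : choiceType) (A : {fset T}) (t : T)
    (g : T -> K) :
  t \in A -> \sum_(u <- A) (u == t)%:R * g u = g t.
Proof.
move=> tA; rewrite (big_fsetD1 t)//= eqxx mul1r big_seq big1 ?addr0// => u.
by rewrite !inE => /andP[/negPf-> _]; rewrite mul0r.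
Qed.

Lemma finite_set_norm_bound (K : numFieldType) (T : choiceType) (A : set T)
    (g : T -> K) :
  finite_set A -> exists M : K, forall x, A x -> `|g x| <= M.
Proof.
move=> fA; exists (\sum_(u <- fset_set A) `|g u|) => x Ax.
rewrite (big_fsetD1 x)/=; last exact: mem_fset_set.
by rewrite lerDl sumr_ge0.
Qed.

Lemma cvg_sumr_seq (K : numFieldType) (I : Type) (r : seq I)
    (u : I -> nat -> K) (l : I -> K) :
  (forall i, u i @ \oo --> l i) ->
  (fun n => \sum_(i <- r) u i n) @ \oo --> \sum_(i <- r) l i.
Proof.
move=> ul; elim: r => [|i r IH].
  by rewrite big_nil; under eq_fun do rewrite big_nil; exact: cvg_cst.
by rewrite big_cons; under eq_fun do rewrite big_cons; apply: cvgD.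
Qed.

(** * The averaging operator and the maximum principle *)

Section Averaging.
Variables (K : numFieldType) (V : choiceType) (e : rel V).
Implicit Types (A B : set V) (g : V -> K) (x y : V) (z : K).

(** The transition operator of the walk on the graph induced on [A]. At a vertex without neighbours
    in [A] its value is 0, since the inverse of 0 is 0. *)
Definition avg A g x : K :=
  (degree e A x)%:R^-1 * \sum_(u <- fset_set (A `&` nbr e x)) g u.

Lemma avg_sum (I : Type) (r : seq I) A (G : I -> V -> K) x :
  avg A (fun u => \sum_(i <- r) G i u) x = \sum_(i <- r) avg A (G i) x.
Proof. by rewrite /avg exchange_big mulr_sumr. Qed.

Lemma avgZ A c g x : avg A (fun u => c * g u) x = c * avg A g x.
Proof. by rewrite /avg -mulr_sumr mulrCA. Qed.

Lemma avgB A g g' x : avg A (fun u => g u - g' u) x = avg A g x - avg A g' x.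
Proof. by rewrite /avg sumrB mulrBr. Qed.

Lemma avg_le A g x M : 0 <= M -> (forall u, A u -> `|g u| <= M) ->
  `|avg A g x| <= M.
Proof.
move=> M0 gM; rewrite /avg normrM normfV normr_nat.
have sM : `|\sum_(u <- fset_set (A `&` nbr e x)) g u| <= (degree e A x)%:R * M.
  rewrite (le_trans (ler_norm_sum _ _ _))// -sumr_fset_const.
  rewrite big_seq [leRHS]big_seq.
  by apply: ler_sum => u /fset_set_mem[/gM].
have [->|d0] := eqVneq (degree e A x) 0%N; first by rewrite invr0 mul0r.
by rewrite ler_pdivrMl// ltr0n lt0n.
Qed.

(* Iterating the averaging step improves a bound M to c + |z|^n M for all n. *)
Lemma maximum_principle A g z c M : geometrically_complete K ->
  `|z| < 1 -> 0 <= c -> (forall x, A x -> `|g x| <= M) ->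
  (forall x, A x -> `|g x| <= c \/ g x = z * avg A g x) ->
  forall x, A x -> `|g x| <= c.
Proof.
move=> hK z1 c0 gM gz x Ax.
have M0 : 0 <= M by rewrite (le_trans _ (gM x Ax)).
apply: (ler_geometric_lim (z := z) (M := M)) => // n.
elim: n x Ax => [|n IH] x Ax.
  by rewrite expr0 mul1r (le_trans (gM _ Ax))// lerDr.
have zM k : 0 <= `|z| ^+ k * M by rewrite mulr_ge0// exprn_ge0.
have [gc|->] := gz _ Ax; first by rewrite (le_trans gc)// lerDl.
have h : `|avg A g x| <= c + `|z| ^+ n * M by rewrite avg_le// addr_ge0.
rewrite normrM (le_trans (ler_wpM2l _ h))// mulrDr exprS mulrA lerD2r.
by rewrite ler_piMl// ltW.
Qed.

(** The maximum principle with [c = 0]. Applied to a difference, it gives uniqueness of bounded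
    solutions with prescribed values on [B]. *)
Lemma avg_unique A (B : set V) g z M : geometrically_complete K ->
  `|z| < 1 -> (forall x, A x -> `|g x| <= M) ->
  (forall x, A x -> B x -> g x = 0) ->
  (forall x, A x -> ~ B x -> g x = z * avg A g x) ->
  forall x, A x -> g x = 0.
Proof.
move=> hK z1 gM g0 gz x Ax; apply/eqP; rewrite -normr_le0.
apply: (maximum_principle hK z1 _ gM) => // u Au.
have [Bu|Bu] := pselect (B u); first by left; rewrite g0 ?normr0.
by right; exact: gz.
Qed.

End Averaging.

(** * The Green function: equation, uniqueness, reversibility *)

Section Green.
Variables (K : numFieldType) (V : choiceType) (e : rel V).
Hypothesis locfin : forall x, finite_set (nbr e x).
Implicit Types (x y : V) (z : K).

Lemma srwS n x y : srw K e n.+1 x y = avg e setT (fun u => srw K e n u y) x.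
Proof. by rewrite /= fsbig_finite// /avg setTI -mulr_sumr. Qed.

Lemma srw_le1 n x y : `|srw K e n x y| <= 1.
Proof.
elim: n x => [|n IH] x; first by rewrite /= normr_nat lern1; case: eqP.
by rewrite srwS avg_le.
Qed.

Hypothesis hK : geometrically_complete K.

Lemma green_cvg x y z : `|z| < 1 ->
  series (fun n => srw K e n x y * z ^+ n) @ \oo --> green e x y z.
Proof.
move=> z1; apply: (hK z1) => n.
by rewrite normrM normrX ler_piMl ?exprn_ge0// srw_le1.
Qed.

(** Decomposition by the first step, done on partial sums: the one with [n.+1] terms at [x] is
    affine in those with [n] terms at the neighbours, and a finite average passes to the limit. *)
Lemma green_eq x y z : `|z| < 1 ->
  green e x y z = (x == y)%:R + z * avg e setT (fun u => green e u y z) x.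
Proof.
move=> z1; apply: cvg_lim; first exact: norm_hausdorff.
rewrite -cvg_shiftS /=.
have -> : (fun n => series (fun k => srw K e k x y * z ^+ k) n.+1) =
  (fun n => (x == y)%:R + z * ((degree e setT x)%:R^-1 *
     \sum_(u <- fset_set (setT `&` nbr e x))
        series (fun k => srw K e k u y * z ^+ k) n)).
  apply/funext => n; rewrite /series/= big_nat_recl//= expr0 mulr1; congr (_ + _).
  rewrite exchange_big/= mulr_sumr mulr_sumr; apply: eq_bigr => k _.
  rewrite -/(srw K e k.+1 x y) srwS /avg -mulr_suml exprS !mulrA.
  by congr (_ * _); rewrite mulrC mulrA.
apply: cvgD; first exact: cvg_cst.
apply: cvgMl_tmp; apply: cvgMl_tmp.
apply: cvg_sumr_seq => u.
exact: green_cvg.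
Qed.

Lemma green_bounded y z : `|z| < 1 ->
  exists M, forall x, `|green e x y z| <= M.
Proof.
move=> z1; have z2 : 0 < 1 - `|z| by rewrite subr_gt0.
(* Every partial sum is at most the geometric sum; the extra 1 pays for replacing the limit by a
   partial sum, whose length may depend on [x]. *)
exists (1 + (1 - `|z|)^-1) => x.
have /cvgrPdist_lt/(_ 1 ltr01)[N _ /(_ N (leqnn _))/= h] := @green_cvg x y z z1.
rewrite -(subrK (series (fun n => srw K e n x y * z ^+ n) N) (green _ _ _ _)).
rewrite (le_trans (ler_normD _ _))// lerD//; first exact: ltW.
rewrite /series/= (le_trans (ler_norm_sum _ _ _))//.
apply: (@le_trans _ _ (\sum_(0 <= k < N) `|z| ^+ k)).
  apply: ler_sum => k _.
  by rewrite normrM normrX ler_piMl ?exprn_ge0// srw_le1.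
rewrite -[leRHS]mulr1 ler_pdivlMl// big_mkord -[1 - _]opprB mulNr -subrX1 opprB.
by rewrite lerBlDr lerDl exprn_ge0.
Qed.

(** The difference of the two sides is bounded and satisfies the homogeneous equation everywhere, so
    [avg_unique] applies with [B] empty. *)
Lemma green_unique y (g : V -> K) c M z : `|z| < 1 ->
  (forall x, `|g x| <= M) ->
  (forall x, g x = c * (x == y)%:R + z * avg e setT g x) ->
  forall x, g x = c * green e x y z.
Proof.
move=> z1 gM gz x; have [N GN] := green_bounded y z1.
apply/eqP; rewrite -subr_eq0; apply/eqP.
apply: (avg_unique (e := e) (A := setT) (B := set0) (z := z)
  (M := M + `|c| * N) (g := fun u => g u - c * green e u y z)) => // u _.
  by rewrite (le_trans (ler_normB _ _))// lerD// normrM ler_wpM2l.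
move=> _; rewrite avgB avgZ gz [in LHS]green_eq// mulrDr mulrBr.
by rewrite opprD addrACA subrr add0r; congr (_ - _); rewrite mulrCA.
Qed.

Hypothesis (sym : symmetric e) (degree_gt0 : forall x, (0 < degree e setT x)%N).

(** Decomposition by the last step, whereas [srw] is defined by the first one. Symmetry of [e] lets
    the sum run over the neighbours of [y]. *)
Lemma srwSr n x y : srw K e n.+1 x y =
  \sum_(u <- fset_set (nbr e y)) (srw K e n x u / (degree e setT u)%:R).
Proof.
elim: n x => [|n IH] x.
  rewrite srwS /avg setTI /=.
  have nxy : (y \in fset_set (nbr e x)) = (x \in fset_set (nbr e y)).
    by rewrite !in_fset_set//; apply/idP/idP; rewrite !inE /nbr/= sym.
  have [xy|xy] := boolP (y \in fset_set (nbr e x)).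
    under eq_bigr do rewrite -[_%:R]mulr1.
    rewrite (sumr_fset_delta (fun=> 1))// mulr1.
    under eq_bigr do rewrite eq_sym.
    by rewrite (sumr_fset_delta (fun u => _%:R^-1)) -?nxy.
  rewrite big_seq big1 ?mulr0; last first.
    by move=> u; case: eqP => // -> h; rewrite h in xy.
  rewrite big_seq big1// => u; case: eqP => [<-|_]; rewrite ?mul0r//.
  by rewrite -nxy (negPf xy).
rewrite srwS /avg.
under eq_bigr do rewrite IH.
rewrite exchange_big/= mulr_sumr; apply: eq_bigr => u _.
by rewrite -/(srw K e n.+1 x u) srwS -mulr_suml mulrA.
Qed.

(** Induction on [n], expanding the left side at its first step and the right side at its last. *)
Lemma srw_reversible n x y :
  (degree e setT x)%:R * srw K e n x y = (degree e setT y)%:R * srw K e n y x.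
Proof.
have d0 u : (degree e setT u)%:R != 0 :> K by rewrite pnatr_eq0 -lt0n.
elim: n x y => [|n IH] x y.
  by rewrite /= eq_sym; case: eqP => [->|]; rewrite ?mulr0.
rewrite srwS srwSr /avg mulVKf// setTI mulr_sumr; apply: eq_bigr => u _.
by apply: (mulfI (d0 u)); rewrite IH [RHS]mulrCA [X in _ = _ * X]mulrC mulfVK.
Qed.

Lemma green_reversible x y z : `|z| < 1 ->
  (degree e setT x)%:R * green e x y z = (degree e setT y)%:R * green e y x z.
Proof.
move=> z1; have /(cvgMl_tmp (a := (degree e setT x)%:R)) h1 := @green_cvg x y z z1.
have /(cvgMl_tmp (a := (degree e setT y)%:R)) h2 := @green_cvg y x z z1.
rewrite -(cvg_lim _ h1)//; apply: cvg_lim => //.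
suff -> : (fun n => (degree e setT x)%:R *
                    series (fun k => srw K e k x y * z ^+ k) n) =
          (fun n => (degree e setT y)%:R *
                    series (fun k => srw K e k y x * z ^+ k) n) by exact: h2.
apply/funext => n; rewrite /series/= !mulr_sumr; apply: eq_bigr => k _.
by rewrite !mulrA srw_reversible.
Qed.

End Green.

(** * The matrix I - z Q_B of a cell and its inverse *)

Lemma sumr_fset_setI (K : nmodType) (T : choiceType) (A : set T) (p : pred T)
    (g : T -> K) : finite_set A ->
  \sum_(u <- fset_set A | p u) g u =
  \sum_(u <- fset_set (A `&` [set u | p u])) g u.
Proof.
move=> fA; rewrite -big_filter; apply: perm_big; apply: uniq_perm => [||u].
- by rewrite filter_uniq// fset_uniq.
- exact: fset_uniq.
have fI : finite_set (A `&` [set u | p u]) by exact: finite_setIl.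
by rewrite mem_filter andbC; apply/andP/idP; rewrite !in_fset_set// !inE.
Qed.

Section FiniteInverse.
Variables (K : numFieldType) (V : choiceType) (e : rel V) (C B : set V) (z : K).
Hypothesis fin_bar : finite_set (bar e C).
Let T := barT e C.
Let n := #|T|.
Let vert (i : 'I_n) : V := val (enum_val i : T).
Implicit Types (g : V -> K) (x y : V).

Let vertP x : bar e C x -> exists i, x = vert i.
Proof.
move=> /(mem_fset_set fin_bar) xT.
by exists (enum_rank (FSetSub xT)); rewrite /vert enum_rankK.
Qed.

Let bar_vert i : bar e C (vert i).
Proof. by apply: fset_set_mem; exact: fsvalP. Qed.

Let vert_eq i j : (vert i == vert j) = (i == j).
Proof. by rewrite /vert (inj_eq val_inj) (inj_eq enum_val_inj). Qed.

Let sum_vert g : \sum_(i < n) g (vert i) = \sum_(u <- fset_set (bar e C)) g u.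
Proof.
rewrite big_seq_fsetE/=.
by rewrite (big_enum_val (A := T) (fun t : T => g (val t))).
Qed.

Let Qmx_col g i : \sum_(j < n) Qmx K e C B i j * g (vert j) =
  (vert i \notin B)%:R * avg e (bar e C) g (vert i).
Proof.
under eq_bigr do rewrite mxE -/(vert i) -/(vert _).
rewrite (sum_vert (fun u => (if e (vert i) u && (vert i \notin B)
  then (degree e (bar e C) (vert i))%:R^-1 else 0) * g u)).
case: (vert i \notin B) => /=; last first.
  by under eq_bigr do rewrite andbF mul0r; rewrite big1// mul0r.
rewrite mul1r /avg mulr_sumr -[nbr _ _]/([set u | e (vert i) u]) -sumr_fset_setI//.
rewrite [RHS]big_mkcond/=; apply: eq_bigr => u _.
by rewrite andbT; case: ifP => // _; rewrite mul0r.
Qed.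

Let M : 'M[K]_n := 1%:M - z *: Qmx K e C B.

Let M_col g i : \sum_(j < n) M i j * g (vert j) =
  g (vert i) - (vert i \notin B)%:R * (z * avg e (bar e C) g (vert i)).
Proof.
under eq_bigr => j _ do rewrite !mxE mulrBl -mulrA.
rewrite sumrB; congr (_ - _).
  rewrite (bigD1 i)//= eqxx mul1r big1 ?addr0// => j /negPf.
  by rewrite eq_sym => ->; rewrite mul0r.
rewrite mulrCA -Qmx_col mulr_sumr; apply: eq_bigr => j _.
by rewrite [in RHS]mxE.
Qed.

Hypothesis (hK : geometrically_complete K) (z1 : `|z| < 1).

(** A kernel vector, read as a function on [bar e C], vanishes on [B] and satisfies [g = z avg g]
    off [B]; such a function is 0 by [avg_unique]. Transposing turns the row kernels of the library
    into column vectors, on which [M] acts by averages. *)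
Let M_unit : M \in unitmx.
Proof.
rewrite -unitmx_tr -row_free_unit -kermx_eq0; apply/eqP/row_matrixP => i.
rewrite row0; set r := row i _.
have rM : r *m M^T = 0 by apply/sub_kermxP; exact: row_sub.
clearbody r.
pose g x : K := if (insub x : option T) is Some t then r 0 (enum_rank t) else 0.
have g_vert j : g (vert j) = r 0 j by rewrite /g /vert valK enum_valK.
have Mg k : \sum_(l < n) M k l * g (vert l) = 0.
  transitivity ((r *m M^T) 0 k); last by rewrite rM mxE.
  rewrite [RHS]mxE.
  by apply: eq_bigr => l _; rewrite g_vert [M^T _ _]mxE mulrC.
apply/rowP => j; rewrite [RHS]mxE -g_vert.
have [N gN] := finite_set_norm_bound g fin_bar.
apply: (avg_unique (e := e) (A := bar e C) (B := B) (z := z) (M := N) (g := g)) => //.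
- move=> _ /vertP[k ->] Bk; have := M_col g k.
  have -> : vert k \notin B = false by apply/negPn; rewrite inE.
  by rewrite mul0r subr0 => <-.
- move=> _ /vertP[k ->] Bk; have := M_col g k.
  have -> : vert k \notin B by rewrite notin_setE.
  by rewrite mul1r Mg => /esym/eqP; rewrite subr_eq0 => /eqP.
Qed.

Let Qstar_vert i j : Qstar e C B z (vert i) (vert j) = invmx M i j.
Proof. by rewrite /Qstar /vert !valK !enum_valK. Qed.

(** The entries of [M *m invmx M = 1]: a first-step equation for the walk stopped on [B]. *)
Lemma Qstar_eq x y : bar e C x -> bar e C y ->
  Qstar e C B z x y = (x == y)%:R +
    (x \notin B)%:R * (z * avg e (bar e C) (fun u => Qstar e C B z u y) x).
Proof.
move=> /vertP[i ->] /vertP[j ->]; rewrite vert_eq.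
have := M_col (fun u => Qstar e C B z u (vert j)) i.
have -> : \sum_(k < n) M i k * Qstar e C B z (vert k) (vert j) = (i == j)%:R.
  have /matrixP/(_ i j) := mulmxV M_unit; rewrite !mxE => <-.
  by apply: eq_bigr => k _; rewrite Qstar_vert.
by move=> ->; rewrite subrK.
Qed.

(** The identity [invmx M *m (M *m g) = g]. Any [g] is recovered from its defect, which is [g]
    itself on [B] and vanishes off [B] wherever [g = z avg g]. *)
Lemma Qstar_representation g x : bar e C x ->
  g x = \sum_(y <- fset_set (bar e C)) Qstar e C B z x y *
    (g y - (y \notin B)%:R * (z * avg e (bar e C) g y)).
Proof.
move=> /vertP[i ->]; rewrite -(sum_vert (fun y => Qstar e C B z (vert i) y *
    (g y - (y \notin B)%:R * (z * avg e (bar e C) g y)))).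
transitivity ((invmx M *m (M *m (\col_j g (vert j)))) i 0).
  by rewrite mulKmx// mxE.
rewrite [LHS]mxE; apply: eq_bigr => k _.
rewrite Qstar_vert -M_col; congr (_ * _); rewrite [LHS]mxE.
by apply: eq_bigr => j _; rewrite [X in _ * X = _]mxE.
Qed.

End FiniteInverse.

(** * Sums over images and partitions *)

Section SetSums.
Variables (T U : choiceType).

Lemma sumr_fset_set_image (K : nmodType) (A : set T) (f : T -> U) (g : U -> K) :
  finite_set A -> set_inj A f ->
  \sum_(u <- fset_set (f @` A)) g u = \sum_(t <- fset_set A) g (f t).
Proof.
move=> fA fI; rewrite fset_set_image// big_imfset//= => x y xA yA.
by apply: fI; rewrite inE; exact: fset_set_mem.
Qed.

Lemma card_fset_set_image (A : set T) (f : T -> U) :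
  finite_set A -> set_inj A f -> #|` fset_set (f @` A)| = #|` fset_set A|.
Proof.
move=> fA fI; rewrite fset_set_image// card_in_imfset// => x y xA yA.
by apply: fI; rewrite inE; exact: fset_set_mem.
Qed.

Lemma sumr_partition (K : pzRingType) (I : set U) (S : U -> set T) (A : set T)
    (g : T -> K) :
  finite_set I -> finite_set A -> A = \bigcup_(i in I) S i ->
  (forall i j t, I i -> I j -> S i t -> S j t -> i = j) ->
  \sum_(t <- fset_set A) g t =
  \sum_(i <- fset_set I) \sum_(t <- fset_set (S i)) g t.
Proof.
move=> fI fA AS dS.
transitivity (\sum_(i <- fset_set I) \sum_(t <- fset_set A) (t \in S i)%:R * g t).
  rewrite exchange_big/=; rewrite big_seq [RHS]big_seq; apply: eq_bigr => t.
  move=> /fset_set_mem; rewrite AS => -[i Ii Sit].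
  transitivity (\sum_(j <- fset_set I) (j == i)%:R * g t).
    by rewrite sumr_fset_delta//; exact: mem_fset_set.
  rewrite big_seq [RHS]big_seq; apply: eq_bigr => j /fset_set_mem Ij.
  congr (_%:R * _); congr nat_of_bool; apply/eqP/idP => [->|]; rewrite inE// => Sjt.
  exact: dS Sit.
rewrite big_seq [RHS]big_seq; apply: eq_bigr => i /fset_set_mem Ii.
transitivity (\sum_(t <- fset_set A | t \in S i) g t).
  rewrite [RHS]big_mkcond; apply: eq_bigr => t _.
  by case: (t \in S i); rewrite ?mul1r ?mul0r.
rewrite sumr_fset_setI//; congr (\sum_(t <- fset_set _) _).
apply/seteqP; split=> t /=; first by case=> _; rewrite inE.
by move=> St; split; [rewrite AS; exists i|rewrite inE].
Qed.

End SetSums.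

(** * Invariance under graph isomorphisms *)

Section Isomorphism.
Variables (K : numFieldType) (V W : choiceType).
Implicit Types (A B : set V).

Lemma graph_iso_nbr A (e : rel V) (A' : set W) (e' : rel W) f x :
  graph_iso A e A' e' f -> A x ->
  A' `&` nbr e' (f x) = f @` (A `&` nbr e x).
Proof.
move=> [[fA fI fS] fe] Ax; apply/seteqP; split=> y.
  move=> [/fS[u Au <-]]; rewrite /nbr/= -fe// => exu.
  by exists u.
move=> [u [Au exu] <-]; split; first exact: fA.
by rewrite /nbr/= -fe.
Qed.

Lemma degree_iso A (e : rel V) (A' : set W) (e' : rel W) f x :
  graph_iso A e A' e' f -> A x -> finite_set (A `&` nbr e x) ->
  degree e' A' (f x) = degree e A x.
Proof.
move=> fi Ax fin; rewrite /degree (graph_iso_nbr fi Ax) card_fset_set_image//.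
by case: fi => -[_ fI _] _ u v; rewrite !inE => -[Au _] [Av _]; apply: fI;
  rewrite inE.
Qed.

Lemma avg_iso A (e : rel V) (A' : set W) (e' : rel W) f x (g : W -> K) :
  graph_iso A e A' e' f -> A x -> finite_set (A `&` nbr e x) ->
  avg e' A' g (f x) = avg e A (g \o f) x.
Proof.
move=> fi Ax fin; rewrite /avg (degree_iso fi)// (graph_iso_nbr fi Ax).
rewrite sumr_fset_set_image//.
by case: fi => -[_ fI _] _ u v; rewrite !inE => -[Au _] [Av _]; apply: fI;
  rewrite inE.
Qed.

End Isomorphism.

(** The matrices are indexed by unrelated enumerations, so no reindexing is attempted. Instead the
    column of [f y] on [D] is pulled back along [f]; its defect on [C] is the delta function at [y],
    and [Qstar_representation] identifies it. *)
Lemma Qstar_iso (K : numFieldType) (V : choiceType) (e : rel V)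
    (C D B B' : set V) (f : V -> V) (z : K) (x y : V) :
  geometrically_complete K -> `|z| < 1 ->
  finite_set (bar e C) -> finite_set (bar e D) ->
  graph_iso (bar e C) e (bar e D) e f ->
  (forall u, bar e C u -> (f u \in B') = (u \in B)) ->
  bar e C x -> bar e C y ->
  Qstar e D B' z (f x) (f y) = Qstar e C B z x y.
Proof.
move=> hK z1 finC finD fi fB Cx Cy.
have fbar u : bar e C u -> bar e D (f u) by case: fi => -[h _ _] _ /h.
rewrite (Qstar_representation B finC hK z1 (fun u => Qstar e D B' z (f u) (f y)))//.
transitivity (\sum_(u <- fset_set (bar e C)) (u == y)%:R * Qstar e C B z x u).
  rewrite big_seq [RHS]big_seq; apply: eq_bigr => u /fset_set_mem Cu.
  rewrite mulrC; congr (_ * _).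
  rewrite [X in X - _]Qstar_eq//; [|exact: fbar..].
  rewrite (avg_iso _ fi)//; last exact: finite_setIl.
  rewrite fB// addrK.
  case: fi => -[_ fI _] _.
  have -> // : (f u == f y) = (u == y).
  by apply/eqP/eqP => [|->//]; apply: fI; rewrite inE.
by rewrite sumr_fset_delta//; exact: mem_fset_set.
Qed.

Lemma graph_iso_comp (U V W : choiceType) (A : set U) e (B : set V) e'
    (D : set W) e'' f g :
  graph_iso A e B e' f -> graph_iso B e' D e'' g ->
  graph_iso A e D e'' (g \o f).
Proof.
move=> [[fB fI fS] fe] [[gD gI gS] ge]; split; last first.
  by move=> x y Ax Ay /=; rewrite fe// ge//; exact: fB.
split.
- by move=> x /fB /gD.
- move=> x y; rewrite !inE => Ax Ay /= /gI h; apply: fI; rewrite ?inE//.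
  by apply: h; rewrite inE; exact: fB.
- by move=> w /gS[v /fS[u Au <-] <-]; exists u.
Qed.

(** * Cells and their boundaries *)

Section Cells.
Variables (V : choiceType) (e : rel V) (F : set V).
Implicit Types (x y u v : V) (C D : set V).

Lemma linked_trans (A : set V) x y u :
  linked e A x y -> linked e A y u -> linked e A x u.
Proof.
move=> [p [pp pl pA]] [q [qp ql qA]]; exists (p ++ q); split.
- by rewrite cat_path pp pl.
- by rewrite last_cat pl.
- move=> t; rewrite in_cons mem_cat orbA => /orP[|tq].
    by move=> h; apply: pA; rewrite in_cons.
  by apply: qA; rewrite in_cons tq orbT.
Qed.

Lemma linked_edge (A : set V) x y : A x -> A y -> e x y -> linked e A x y.
Proof.
move=> Ax Ay exy; exists [:: y]; split => //=; first by rewrite exy.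
by move=> t; rewrite !inE => /orP[]/eqP->.
Qed.

Lemma linked_refl (A : set V) x : A x -> linked e A x x.
Proof.
by move=> Ax; exists [::]; split => // t; rewrite mem_seq1 => /eqP->; rewrite inE.
Qed.

Lemma linked_last (A : set V) x y : linked e A x y -> A y.
Proof. by move=> [p [_ <- pA]]; have := pA _ (mem_last x p); rewrite inE. Qed.

Lemma linked_sym (A : set V) x y :
  symmetric e -> linked e A x y -> linked e A y x.
Proof.
move=> sym [p]; elim: p x => [|t p IH] x [/= pp pl pA].
  by rewrite -pl; apply: linked_refl; have := pA x (mem_head _ _); rewrite inE.
move/andP: pp => [ext pp].
have [Ax At] : A x /\ A t.
  by split; apply/set_mem/pA; rewrite !inE eqxx ?orbT.
apply: (@linked_trans _ _ t); last by apply: linked_edge => //; rewrite sym.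
by apply: IH; split=> // s sp; apply: pA; rewrite in_cons sp orbT.
Qed.

Lemma mem_cell_of x : ~ F x -> cell_of e F x x.
Proof. exact: linked_refl. Qed.

Lemma cells_cell_of x : ~ F x -> cells e F (cell_of e F x).
Proof. by move=> Fx; exists x. Qed.

Lemma cell_notF C x : cells e F C -> C x -> ~ F x.
Proof. by move=> [y Fy <-] /linked_last. Qed.

Lemma cell_of_eq C x : symmetric e -> cells e F C -> C x -> C = cell_of e F x.
Proof.
move=> sym [y Fy <-] yx; apply/seteqP; split=> t.
  by apply: linked_trans; exact: linked_sym.
exact: linked_trans.
Qed.

(** A boundary vertex off [F] would be linked to the cell inside the complement of [F], hence would
    belong to the cell. *)
Lemma theta_cell C v : cells e F C -> theta e C v -> F v.
Proof.
move=> [y Fy <-] [nCv [u Cu euv]]; apply: contrapT => Fv; apply: nCv.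
apply: (linked_trans Cu); apply: linked_edge => //.
exact: linked_last Cu.
Qed.

Lemma cell_nbr_bar C x u : C x -> e x u -> bar e C u.
Proof.
move=> Cx exu; have [Cu|nCu] := pselect (C u); first by left.
by right; split=> //; exists x.
Qed.

Lemma cell_bar_nbr C x : C x -> bar e C `&` nbr e x = [set: V] `&` nbr e x.
Proof.
move=> Cx; apply/seteqP; split=> u [_ xu]; split=> //.
exact: cell_nbr_bar xu.
Qed.

Lemma cell_degree C x : C x -> degree e (bar e C) x = degree e setT x.
Proof. by move=> Cx; rewrite /degree cell_bar_nbr. Qed.

Lemma cell_avg (K : numFieldType) C x (g : V -> K) : C x ->
  avg e (bar e C) g x = avg e setT g x.
Proof. by move=> Cx; rewrite /avg cell_degree// cell_bar_nbr. Qed.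

Lemma finite_bar C : (forall x, finite_set (nbr e x)) ->
  finite_set C -> finite_set (bar e C).
Proof.
move=> locfin fC; rewrite finite_setU; split => //.
apply: (sub_finite_set (B := \bigcup_(x in C) nbr e x)); last exact: bigcup_finite.
by move=> v [_ [u Cu euv]]; exists u.
Qed.

(** By connectedness, an isolated vertex would be the only vertex. *)
Lemma infinite_graph_degree_gt0 x : infinite_graph e -> (0 < degree e setT x)%N.
Proof.
move=> hX; rewrite /degree setTI cardfs_gt0; apply/fset0Pn.
suff [y xy] : exists y, e x y.
  by exists y; apply: mem_fset_set => //; exact: graph_locally_finite.
apply: contrapT => nx; apply: (graph_infinite hX).
apply: (sub_finite_set (B := [set x])); last exact: finite_set1.
move=> y _ /=; have [[|t p] [/= pp pl _]] := graph_connected hX x y; first exact/esym.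
by move/andP: pp => [xt _]; exfalso; apply: nx; exists t.
Qed.

End Cells.

(** * Symmetry of the cells and the functions d and f *)

Section SelfSimilarGreen.
Variables (K : numFieldType) (V : choiceType) (e : rel V) (F : set V).
Variables (psi phi : V -> V).
Hypotheses (hK : geometrically_complete K) (hX : infinite_graph e).
Hypotheses (hS : symmetrically_self_similar e F psi) (hphi : cancel psi phi).
Variables (C0 : set V) (a b : V).
Hypotheses (hC0 : cells e F C0) (ha : theta e C0 a) (hb : theta e C0 b).
Hypothesis hab : a <> b.
Variable z : K.
Hypothesis z1 : `|z| < 1.
Implicit Types (C D : set V) (u v w x y : V) (g : V -> K).

Let sym : symmetric e := graph_sym hX.
Let locfin x : finite_set (nbr e x) := graph_locally_finite hX x.
Let deg_gt0 x := infinite_graph_degree_gt0 x hX.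
Let hSS := sss_self_similar hS.

Let d := d_fun e C0 a b z.
Let f := f_fun e C0 a z.
(** The share of a single boundary vertex in [d]: by definition [d = t * c]. *)
Let c := Qstar e C0 (theta e C0 `\ a) z a b.
Let t : K := #|` fset_set (theta e C0)|%:R - 1.

Lemma finite_cell_bar C : cells e F C -> finite_set (bar e C).
Proof. by move=> hC; apply: finite_bar => //; exact: (axiomS1_finite hS hC). Qed.

Lemma finite_cell_theta C : cells e F C -> finite_set (theta e C).
Proof. by move=> /finite_cell_bar; rewrite finite_setU => -[]. Qed.

(** (S1) carries [a] and [b] to some two distinct boundary vertices of [C], and (S3) moves this pair
    to [v] and [y]. *)
Lemma cell_iso_pair C v y :
  cells e F C -> theta e C v -> theta e C y -> v <> y ->
  exists2 h, graph_iso (bar e C0) e (bar e C) e h &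
    [/\ h @` theta e C0 = theta e C, h a = v & h b = y].
Proof.
move=> hC Cv Cy vy; have [h hi hth] := axiomS1_iso hS hC0 hC.
have hT u : theta e C0 u -> theta e C (h u) by rewrite -hth => Cu; exists u.
have hne : h a <> h b.
  by case: hi => -[_ hI _] _ /hI h'; apply: hab; apply: h'; rewrite inE; right.
have [k [ki kth ka kb]] := axiomS3 hS hC (hT _ ha) (hT _ hb) hne Cv Cy vy.
exists (k \o h); first exact: graph_iso_comp ki.
by split => //; rewrite -kth -hth image_comp.
Qed.

Lemma theta_other C v : cells e F C -> exists2 y, theta e C y & v <> y.
Proof.
move=> hC; have [h hi hth] := axiomS1_iso hS hC0 hC.
have hT u : theta e C0 u -> theta e C (h u) by rewrite -hth => Cu; exists u.
have hne : h a <> h b.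
  by case: hi => -[_ hI _] _ /hI h'; apply: hab; apply: h'; rewrite inE; right.
have [->|nv] := pselect (v = h a); first by exists (h b) => //; exact: hT.
by exists (h a) => //; exact: hT.
Qed.

Lemma cell_degree_theta C v : cells e F C -> theta e C v ->
  degree e (bar e C) v = degree e (bar e C0) a.
Proof.
move=> hC Cv; have [y Cy vy] := theta_other v hC.
have [h hi [_ <- _]] := cell_iso_pair hC Cv Cy vy.
apply: (degree_iso hi); first by right.
by apply: finite_setIl; exact: finite_cell_bar.
Qed.

(** The isomorphism carrying [a] to [v] also carries the absorbing set of [C0] to that of [C].
    Taking [x0] to be [b] or [a] shows that [c] and [f] depend on neither the cell nor the boundary
    vertices. *)
Let Qstar_pair C v y x0 : cells e F C -> theta e C v -> theta e C y -> v <> y ->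
  bar e C0 x0 -> exists2 h : V -> V,
  h a = v /\ h b = y &
  Qstar e C (theta e C `\ v) z v (h x0) = Qstar e C0 (theta e C0 `\ a) z a x0.
Proof.
move=> hC Cv Cy vy C0x; have [h hi [hth h1 h2]] := cell_iso_pair hC Cv Cy vy.
exists h => //; rewrite -{2}h1.
apply: Qstar_iso => //; try exact: finite_cell_bar; last by right.
move=> u Cu; have hI := hi.1.
case: hI => _ hI _.
have inj u' : bar e C0 u' -> h u = h u' -> u = u'.
  by move=> Cu' huu; apply: hI; rewrite ?inE.
apply/idP/idP; rewrite !inE /= -hth -h1.
  move=> [[u' Cu' huu'] hua]; split.
    by rewrite (inj u')//; right.
  by move=> ua; apply: hua; rewrite ua.
move=> [Cu' ua]; split; first by exists u.
by move=> /(inj a) h'; apply: ua; apply: h'; right.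
Qed.

Lemma Qstar_theta C v y : cells e F C -> theta e C v -> theta e C y -> v <> y ->
  Qstar e C (theta e C `\ v) z v y = c.
Proof.
move=> hC Cv Cy vy; have C0b : bar e C0 b by right.
by have [h [_ <-] ->] := Qstar_pair hC Cv Cy vy C0b.
Qed.

Lemma Qstar_theta_diag C v : cells e F C -> theta e C v ->
  Qstar e C (theta e C `\ v) z v v = f.
Proof.
move=> hC Cv; have [y Cy vy] := theta_other v hC; have C0a : bar e C0 a by right.
by have [h [ha' _]] := Qstar_pair hC Cv Cy vy C0a; rewrite ha'.
Qed.

Lemma card_thetaD1 C v : cells e F C -> theta e C v ->
  #|` fset_set (theta e C `\ v)|%:R = t.
Proof.
move=> hC Cv; have [h hi hth] := axiomS1_iso hS hC0 hC.
have finC := finite_cell_theta hC; have fin0 := finite_cell_theta hC0.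
have hI : set_inj (theta e C0) h.
  by case: hi => -[_ hI _] _ x y; rewrite !inE => Cx Cy; apply: hI; rewrite inE; right.
rewrite /t -(card_fset_set_image fin0 hI) hth fset_setD1//.
by rewrite [in RHS](cardfsD1 v) mem_fset_set// natrD addrAC subrr add0r.
Qed.

(** [U x] is the generating function of the walk from [x] absorbed on [B]. It is 1 on [B] and
    satisfies [U = z avg U] elsewhere, so [|U| <= 1]; by symmetry [U a = d]. *)
Lemma normr_d_fun_lt1 : `|d| < 1.
Proof.
pose B := theta e C0 `\ a.
have finB : finite_set B by apply: finite_setD; exact: finite_cell_theta.
have fin0 := finite_cell_bar hC0.
have Bbar y : B y -> bar e C0 y by move=> [? _]; right.
pose U x := \sum_(y <- fset_set B) Qstar e C0 B z x y.
have Ua : U a = d.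
  transitivity (\sum_(y <- fset_set B) c).
    rewrite /U big_seq [RHS]big_seq; apply: eq_bigr => y /fset_set_mem[Cy ya].
    by apply: Qstar_theta => // ay; apply: ya.
  by rewrite sumr_fset_const card_thetaD1.
have UB x : bar e C0 x -> B x -> U x = 1.
  move=> Cx Bx; transitivity (\sum_(y <- fset_set B) (y == x)%:R * (1 : K)).
    rewrite /U big_seq [RHS]big_seq; apply: eq_bigr => y /fset_set_mem /Bbar Cy.
    rewrite (Qstar_eq B fin0 hK z1)// eq_sym mulr1.
    have -> : x \notin B = false by apply/negPn; rewrite inE.
    by rewrite mul0r addr0.
  by rewrite (sumr_fset_delta (fun=> 1))//; exact: mem_fset_set.
have Uz x : bar e C0 x -> ~ B x -> U x = z * avg e (bar e C0) U x.
  move=> Cx Bx; rewrite avg_sum mulr_sumr /U big_seq [RHS]big_seq.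
  apply: eq_bigr => y /fset_set_mem By.
  rewrite [LHS](Qstar_eq B fin0 hK z1)//; last exact: Bbar.
  have -> : (x == y) = false by apply/eqP => xy; apply: Bx; rewrite xy.
  have -> : x \notin B by rewrite notin_setE.
  by rewrite add0r mul1r.
have [M UM] := finite_set_norm_bound U fin0.
have U1 : forall x, bar e C0 x -> `|U x| <= 1.
  apply: (maximum_principle (e := e) hK z1 _ UM) => // x Cx.
  have [Bx|Bx] := pselect (B x); first by left; rewrite UB// normr1.
  by right; exact: Uz.
(* As [a] is not in [B], one more step from [a] gains a factor [z], which makes the bound strict. *)
rewrite -Ua Uz; [|by right|by case=> _ /(_ erefl)].
by rewrite normrM (le_lt_trans _ z1)// ler_piMr// avg_le.
Qed.

(** [Qstar_representation] with [B] the boundary without [v]: the defect of [g] is [g] on [B],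
    vanishes in the cell, and survives at [v]. The coefficients are [c] and [f]. *)
Lemma cell_boundary_eq C v g : cells e F C -> theta e C v ->
  (forall x, C x -> g x = z * avg e setT g x) ->
  g v = c * \sum_(y <- fset_set (theta e C `\ v)) g y +
    f * (g v - z * avg e (bar e C) g v).
Proof.
move=> hC Cv gC; have finC := finite_cell_bar hC.
have Cbv : bar e C v by right.
rewrite {1}(Qstar_representation (theta e C `\ v) finC hK z1 g Cbv).
transitivity (\sum_(y <- fset_set (bar e C))
   ((if y \in theta e C `\ v then c * g y else 0) +
    (y == v)%:R * (f * (g y - z * avg e (bar e C) g y)))).
  rewrite big_seq [RHS]big_seq; apply: eq_bigr => y /fset_set_mem Cby.
  have [->|yv] := eqVneq y v.
    have -> : (v \in theta e C `\ v) = false.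
      by apply/negP; rewrite inE => -[_]; apply.
    by rewrite Qstar_theta_diag// !mul1r add0r.
  have [Cy|Cy] := pselect (theta e C y).
    have -> : y \in theta e C `\ v by rewrite inE; split=> //; exact/eqP.
    rewrite !mul0r addr0 subr0 Qstar_theta// => vy.
    by rewrite vy eqxx in yv.
  have -> : (y \in theta e C `\ v) = false.
    by apply/negP; rewrite inE => -[].
  case: Cby => // Cy'.
  by rewrite cell_avg// mul1r -gC// subrr mulr0 mul0r addr0.
rewrite big_split/= sumr_fset_delta; last exact: mem_fset_set.
congr (_ + _); rewrite -big_mkcond/= sumr_fset_setI// mulr_sumr.
congr (\sum_(y <- fset_set _) _).
apply/seteqP; split=> y /=; first by case=> _; rewrite inE.
by move=> Cy; split; [right; case: Cy|rewrite inE].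
Qed.

(** * Passing from the cells around a vertex to the reduced graph *)

Let cells_at v : set (set V) := [set C | cells e F C /\ theta e C v].

(** Each of these cells is the cell of one of the finitely many neighbours of [v]. *)
Let finite_cells_at v : F v -> finite_set (cells_at v).
Proof.
move=> Fv; apply: (sub_finite_set (B := cell_of e F @` nbr e v)).
  move=> C [hC [_ [u Cu euv]]]; exists u; first by rewrite /nbr/= sym.
  exact/esym/cell_of_eq.
exact: finite_image.
Qed.

(** By (F1) every neighbour of [v] lies in a cell with [v] on its boundary. Two such cells already
    share [v], so by (F2) they share no neighbour of [v]. *)
Let sum_nbr v g : F v -> \sum_(u <- fset_set (setT `&` nbr e v)) g u =
  \sum_(C <- fset_set (cells_at v)) \sum_(u <- fset_set (bar e C `&` nbr e v)) g u.
Proof.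
move=> Fv; apply: sumr_partition.
- exact: finite_cells_at.
- by rewrite setTI.
- apply/seteqP; split=> u; last by move=> [C _ [_ vu]].
  move=> [_ vu]; have Fu : ~ F u.
    by move=> Fu; have := axiomF1 hSS Fv Fu; rewrite vu.
  have Cu := mem_cell_of e Fu; exists (cell_of e F u); last by split => //; left.
  split; first exact: cells_cell_of.
  split; first by move=> /(cell_notF (cells_cell_of e Fu)).
  by exists u => //; rewrite sym.
- move=> C D u [hC Cv] [hD Dv] [Cu vu] [Du _]; apply: contrapT => CD.
  have := axiomF2 hSS hC hD CD.
  have hu : (bar e C `&` bar e D) u by [].
  have hv : (bar e C `&` bar e D) v by split; right.
  by move=> /(_ _ _ hu hv) uv; move: vu; rewrite /nbr/= uv (graph_irr hX).
Qed.

(** The same partition for the reduced graph: by (F2) two cells at [v] have no second boundary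
    vertex in common. *)
Let sum_reduced v g : F v ->
  \sum_(u <- fset_set (F `&` nbr (reduced_adj e F) v)) g u =
  \sum_(C <- fset_set (cells_at v)) \sum_(u <- fset_set (theta e C `\ v)) g u.
Proof.
move=> Fv; have E : F `&` nbr (reduced_adj e F) v =
    \bigcup_(C in cells_at v) (theta e C `\ v).
  apply/seteqP; split=> u.
    move=> [_ /andP[vu /asboolP[C [hC Cv Cu]]]]; exists C => //.
    by split=> // uv; rewrite uv eqxx in vu.
  move=> [C [hC Cv] [Cu uv]]; split; first exact: theta_cell Cu.
  apply/andP; split; first by apply/eqP => vu; apply: uv.
  by apply/asboolP; exists C.
apply: sumr_partition => //.
- exact: finite_cells_at.
- rewrite E; apply: bigcup_finite; first exact: finite_cells_at.
  by move=> C [hC _]; apply: finite_setD; exact: finite_cell_theta.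
- move=> C D u [hC Cv] [hD Dv] [Cu uv] [Du _]; apply: contrapT => CD.
  have hu : (bar e C `&` bar e D) u by split; right.
  have hv : (bar e C `&` bar e D) v by split; right.
  by apply: uv; exact: axiomF2 hSS _ _ hC hD CD _ _ hu hv.
Qed.

Let N v : K := #|` fset_set (cells_at v)|%:R.
Let D0 : K := (degree e (bar e C0) a)%:R.

Let degreeE A (e' : rel V) v : (degree e' A v)%:R =
  \sum_(u <- fset_set (A `&` nbr e' v)) (1 : K).
Proof. by rewrite sumr_fset_const mulr1. Qed.

Let degree_nbr v : F v -> (degree e setT v)%:R = N v * D0.
Proof.
move=> Fv; rewrite degreeE sum_nbr// -sumr_fset_const big_seq [RHS]big_seq.
apply: eq_bigr => C /fset_set_mem[hC Cv].
by rewrite -degreeE cell_degree_theta.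
Qed.

Let degree_reduced v : F v -> (degree (reduced_adj e F) F v)%:R = N v * t.
Proof.
move=> Fv; rewrite degreeE sum_reduced// -sumr_fset_const big_seq [RHS]big_seq.
apply: eq_bigr => C /fset_set_mem[hC Cv].
by rewrite sumr_fset_const mulr1 card_thetaD1.
Qed.

Let psi_phi v : F v -> psi (phi v) = v.
Proof. by move=> Fv; have [[_ _ /(_ _ Fv)[p _ <-]] _] := axiomF3 hSS; rewrite hphi. Qed.

Let psiF v : F (psi v).
Proof. by have [[h _ _] _] := axiomF3 hSS; exact: h. Qed.

Let degree_psi p : degree (reduced_adj e F) F (psi p) = degree e setT p.
Proof. by apply: (degree_iso (axiomF3 hSS)) => //; rewrite setTI. Qed.

Let avg_psi p g : avg (reduced_adj e F) F g (psi p) = avg e setT (g \o psi) p.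
Proof. by apply: (avg_iso _ (axiomF3 hSS)) => //; rewrite setTI. Qed.

Let degree_neq0 v : (degree e setT v)%:R != 0 :> K.
Proof. by rewrite pnatr_eq0 -lt0n. Qed.

(** The degree of [phi v] in X is that of [v] in the reduced graph, [N v * t], while [v] has degree
    [N v * D0] in X. The ratio is thus the same for all [v]. *)
Lemma degree_phi v : F v ->
  (degree e setT (phi v))%:R * D0 = (degree e setT v)%:R * t.
Proof.
move=> Fv; rewrite -degree_psi psi_phi// degree_reduced// degree_nbr//.
by rewrite mulrAC.
Qed.

(** The average of [cell_boundary_eq] over the [N v] cells at [v]: the sums over boundaries and over
    neighbours assemble into averages on the reduced graph and on X. *)
Lemma reduced_equation v g : F v ->
  (forall x, ~ F x -> g x = z * avg e setT g x) ->
  g v = f * (g v - z * avg e setT g v) + d * avg (reduced_adj e F) F g v.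
Proof.
move=> Fv gz.
have : N v * D0 != 0 by rewrite -degree_nbr// degree_neq0.
rewrite mulf_eq0 negb_or => /andP[N0 D00].
(* [t] is nonzero because [N v * t] is the degree of [phi v] in X. *)
have : N v * t != 0 by rewrite -degree_reduced// -(psi_phi Fv) degree_psi degree_neq0.
rewrite mulf_eq0 negb_or => /andP[_ t0].
have E : \sum_(C <- fset_set (cells_at v)) g v =
    \sum_(C <- fset_set (cells_at v))
      (c * \sum_(y <- fset_set (theta e C `\ v)) g y +
       f * (g v - z * (D0^-1 * \sum_(u <- fset_set (bar e C `&` nbr e v)) g u))).
  rewrite big_seq [RHS]big_seq; apply: eq_bigr => C /fset_set_mem[hC Cv].
  rewrite {1}(cell_boundary_eq hC Cv) /avg ?cell_degree_theta// => x Cx.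
  by apply: gz; exact: (cell_notF hC Cx).
move: E; rewrite sumr_fset_const -/(N v) big_split/= -!mulr_sumr sumrB.
rewrite sumr_fset_const -!mulr_sumr -sum_nbr// -sum_reduced// -/(N v).
set S1 := \sum_(_ <- _) _; set S2 := \sum_(_ <- _) _ => E.
apply: (mulfI N0); rewrite E /avg degree_nbr// degree_reduced// -/S1 -/S2.
rewrite /d /d_fun -/c -/t; field.
by rewrite N0 D00 t0.
Qed.

(** * The formulas for the Green function *)

(** In [reduced_equation] the defect [g v - z avg g v] is the delta function at [w]. Transported by
    [psi], the equation becomes the Green equation on X with parameter [d] and source [f] at
    [phi w], and [green_unique] applies. *)
Lemma green_boundary v w : F v -> F w ->
  green e v w z = green e (phi v) (phi w) d * f.
Proof.
move=> Fv Fw; pose g u := green e u w z.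
have gz x : g x = (x == w)%:R + z * avg e setT g x by exact: green_eq.
have gF x : ~ F x -> g x = z * avg e setT g x.
  move=> Fx; rewrite {1}gz; case: eqP => [xw|_]; last by rewrite add0r.
  by rewrite xw in Fx.
have [M gM] := green_bounded locfin hK w z1.
rewrite -[LHS]/(g v) -[v in LHS]psi_phi// mulrC.
apply: (green_unique locfin hK normr_d_fun_lt1 (g := g \o psi) (M := M)) => p.
  exact: gM.
rewrite /= {1}(reduced_equation (psiF p) gF) avg_psi {1}gz addrK.
have -> // : (psi p == w) = (p == phi w).
by apply/eqP/eqP => [<-|->]; rewrite ?hphi ?psi_phi.
Qed.

(** [Qstar_representation] with [B] the whole boundary: the defect of the Green function is the
    delta function at [y] inside the cell and the Green function itself on the boundary. *)
Lemma green_cell x y : ~ F x ->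
  green e x y z = (y \in cell_of e F x)%:R * h_fun e (cell_of e F x) x y z +
    \sum_(v <- fset_set (theta e (cell_of e F x)))
      h_fun e (cell_of e F x) x v z * green e v y z.
Proof.
move=> Fx; have hC := cells_cell_of e Fx; have Cx := mem_cell_of e Fx.
move: (cell_of e F x) hC Cx => C hC Cx; pose g u := green e u y z.
have finC := finite_cell_bar hC; have Cbx : bar e C x by left.
have gz u : g u = (u == y)%:R + z * avg e setT g u by exact: green_eq.
rewrite -[LHS]/(g x) {1}(Qstar_representation (theta e C) finC hK z1 g Cbx).
transitivity (\sum_(u <- fset_set (bar e C))
   ((if u \in theta e C then h_fun e C x u z * g u else 0) +
    (if u \in C then (u == y)%:R * h_fun e C x u z else 0))).
  rewrite big_seq [RHS]big_seq; apply: eq_bigr => u /fset_set_mem[Cu|Tu].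
    have nT : (u \in theta e C) = false by apply/negP; rewrite inE => -[].
    have -> : u \in C by rewrite inE.
    rewrite nT add0r mul1r cell_avg// [X in X - _]gz addrK mulrC.
    by rewrite /h_fun.
  have -> : u \in theta e C by rewrite inE.
  have -> : (u \in C) = false by apply/negP; rewrite inE; case: Tu.
  by rewrite mul0r subr0 addr0.
rewrite big_split/= addrC; congr (_ + _); rewrite -big_mkcond/= sumr_fset_setI//.
  rewrite (_ : _ `&` _ = C); last first.
    by apply/seteqP; split=> u /=; [case=> _|split; [left|]]; rewrite ?inE.
  have finC' := axiomS1_finite hS hC.
  have [Cy|Cy] := boolP (y \in C).
    by rewrite sumr_fset_delta ?mul1r//; apply: mem_fset_set => //; rewrite inE in Cy.
  rewrite mul0r big_seq big1// => u /fset_set_mem Cu.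
  by case: eqP => [uy|_]; rewrite ?mul0r//; move: Cy; rewrite notin_setE -uy.
rewrite (_ : _ `&` _ = theta e C)//.
by apply/seteqP; split=> u /=; [case=> _|split; [right|]]; rewrite ?inE.
Qed.

Lemma green_cell_boundary x w : ~ F x -> F w ->
  green e x w z = \sum_(v <- fset_set (theta e (cell_of e F x)))
    h_fun e (cell_of e F x) x v z * green e (phi v) (phi w) d * f.
Proof.
move=> Fx Fw; have hC := cells_cell_of e Fx; rewrite green_cell//.
have -> : (w \in cell_of e F x) = false.
  by apply/negP; rewrite inE => /(cell_notF hC).
rewrite mul0r add0r big_seq [RHS]big_seq; apply: eq_bigr => v /fset_set_mem Cv.
by rewrite green_boundary// ?mulrA//; exact: theta_cell Cv.
Qed.

(** Reversibility is used twice: at [z] to exchange [v] and [y], and at [d] to exchange [phi v] and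
    [phi w]. The degree of [w] left over is the denominator in [htilde]. *)
Lemma green_boundary_cell v y : F v -> ~ F y ->
  green e v y z = \sum_(w <- fset_set (theta e (cell_of e F y)))
    green e (phi v) (phi w) d * f * htilde e (cell_of e F y) w y z.
Proof.
move=> Fv Fy; have hC := cells_cell_of e Fy.
apply: (mulfI (degree_neq0 v)); rewrite green_reversible//.
rewrite green_cell_boundary// !mulr_sumr big_seq [RHS]big_seq.
apply: eq_bigr => w /fset_set_mem Cw; have Fw := theta_cell hC Cw.
rewrite /htilde cell_degree; last exact: mem_cell_of.
have := green_reversible locfin hK sym deg_gt0 (phi v) (phi w) normr_d_fun_lt1.
have [v0 w0] := (degree_neq0 (phi v), degree_neq0 (phi w)).
have [ev ew] := (degree_phi Fv, degree_phi Fw).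
have : N v * D0 != 0 by rewrite -degree_nbr// degree_neq0.
rewrite mulf_eq0 negb_or => /andP[_ D00] rev.
have : (degree e setT (phi v))%:R * D0 != 0 by rewrite mulf_neq0.
rewrite ev mulf_eq0 negb_or => /andP[_ t0].
(* The constant ratio in [degree_phi] allows the degrees of [phi v] and [phi w] to be replaced by
   those of [v] and [w]. *)
have rev' : (degree e setT v)%:R * green e (phi v) (phi w) d =
            (degree e setT w)%:R * green e (phi w) (phi v) d.
  apply: (mulIf t0); rewrite mulrAC -ev mulrAC rev mulrAC ew.
  by rewrite mulrAC.
rewrite -!mulrA [RHS]mulrA rev'; field.
exact: degree_neq0.
Qed.

(** [green_cell] leaves the cell of [x] through its boundary, and [green_boundary_cell] continues
    from there to [y]. *)
Lemma green_cell_cell x y : ~ F x -> ~ F y ->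
  green e x y z =
    (cell_of e F x == cell_of e F y)%:R * h_fun e (cell_of e F x) x y z +
    \sum_(v <- fset_set (theta e (cell_of e F x)))
    \sum_(w <- fset_set (theta e (cell_of e F y)))
      h_fun e (cell_of e F x) x v z * green e (phi v) (phi w) d * f *
      htilde e (cell_of e F y) w y z.
Proof.
move=> Fx Fy; have hC := cells_cell_of e Fx; rewrite green_cell//.
congr (_%:R * _ + _).
  congr nat_of_bool; apply/idP/eqP => [|->]; rewrite inE; first exact: cell_of_eq.
  exact: mem_cell_of.
rewrite big_seq [RHS]big_seq; apply: eq_bigr => v /fset_set_mem Cv.
have Fv := theta_cell hC Cv.
rewrite green_boundary_cell// mulr_sumr; apply: eq_bigr => w _.
by rewrite !mulrA.
Qed.

End SelfSimilarGreen.

Theorem theorem5p1 (R : realType) (V : choiceType) (e : rel V) (F : set V)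
    (psi phi : V -> V)
    (hX : infinite_graph e)
    (hS : symmetrically_self_similar e F psi)
    (hphi : cancel psi phi)
    (C0 : set V) (a b : V)
    (hC0 : cells e F C0) (ha : theta e C0 a) (hb : theta e C0 b) (hab : a <> b)
    (x y v w : V) (hx : ~ F x) (hy : ~ F y) (hv : F v) (hw : F w)
    (z : R[i]) (hz : `|z| < 1) :
  let d := d_fun e C0 a b z in
  let f := f_fun e C0 a z in
  let Cx := cell_of e F x in
  let Cy := cell_of e F y in
  [/\ green e v w z = green e (phi v) (phi w) d * f,
      green e x w z =
        \sum_(v' \in theta e Cx)
          (h_fun e Cx x v' z * green e (phi v') (phi w) d * f),
      green e v y z =
        \sum_(w' \in theta e Cy)
          (green e (phi v) (phi w') d * f * htilde e Cy w' y z)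
    & green e x y z =
        (Cx == Cy)%:R * h_fun e Cx x y z +
        \sum_(v' \in theta e Cx) \sum_(w' \in theta e Cy)
          (h_fun e Cx x v' z * green e (phi v') (phi w') d * f *
           htilde e Cy w' y z)].
Proof.
move=> d f Cx Cy; have hK := @complex_geometrically_complete R.
have fx := finite_cell_theta hX hS (cells_cell_of e hx).
have fy := finite_cell_theta hX hS (cells_cell_of e hy).
split.
- exact: (green_boundary hK hX hS hphi hC0 ha hb hab hz).
- rewrite fsbig_finite//.
  exact: (green_cell_boundary hK hX hS hphi hC0 ha hb hab hz).
- rewrite fsbig_finite//.
  exact: (green_boundary_cell hK hX hS hphi hC0 ha hb hab hz).
- rewrite fsbig_finite//.
  under eq_bigr do rewrite fsbig_finite//.
  exact: (green_cell_cell hK hX hS hphi hC0 ha hb hab hz).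
Qed.
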